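(* Let $(L,\cdot)$ be a loop, $A(L)$ a group of automorphisms of $(L,\cdot)$, and suppose the $A(L)$-holomorph $H(L)$ of $(L,\cdot)$ is an Osborn loop. Then the following triangles of maps commute. (a) The triangle with $\varphi:\Phi(L,\cdot)\to\Lambda(L,\cdot),\Psi(L,\cdot)$ an isomorphism, $\delta:\Lambda(L,\cdot)\to N_\lambda(L,\cdot)$ and $\beta:\Psi(L,\cdot)\to N_\mu(L,\cdot)$ isomorphisms, and $\sigma:\Phi(L,\cdot)\to N_\mu(L,\cdot),N_\lambda(L,\cdot)$; that is, $\sigma=\varphi\delta$ and $\sigma=\varphi\beta$. On elements, for all $x\in L$ and $\alpha\in A(L)$: $\varphi(R_{x\alpha\cdot x^{\rho}})=L_{x\alpha\cdot x^{\rho}}$, $\delta(L_{x\alpha\cdot x^{\rho}})=\beta(L_{x\alpha\cdot x^{\rho}})=x\alpha\cdot x^{\rho}$ and $\sigma(R_{x\alpha\cdot x^{\rho}})=x\alpha\cdot x^{\rho}$. (b) The triangle with $\varphi:\mathcal{P}(L,\cdot),\Phi(L,\cdot)\to\Psi(L,\cdot)$ an isomorphism, $\beta:\Psi(L,\cdot)\to N_\mu(L,\cdot),N_\rho(L,\cdot)$ an isomorphism, and $\psi:\mathcal{P}(L,\cdot)\to N_\rho(L,\cdot)$, $\sigma:\Phi(L,\cdot)\to N_\mu(L,\cdot)$; that is, $\sigma=\varphi\beta$ and $\psi=\varphi\beta$. On elements, for all $x\in L$ and $\phi\in A(L)$: $\varphi(R_{x^{\lambda}\cdot x\phi^{-1}})=L_{x^{\lambda}\cdot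 x\phi^{-1}}$, $\beta(L_{x^{\lambda}\cdot x\phi^{-1}})=x^{\lambda}\cdot x\phi^{-1}$ and $\psi(R_{x^{\lambda}\cdot x\phi^{-1}})=\sigma(R_{x^{\lambda}\cdot x\phi^{-1}})=x^{\lambda}\cdot x\phi^{-1}$.
   Context: Maps on $L$ are written on the right. All compositions are from left to right; in particular $\sigma=\varphi\delta$ means $\sigma(U)=\delta(\varphi(U))$. When several groups are listed as source or target of one arrow (e.g. $\varphi:\Phi\to\Lambda,\Psi$), the same map is regarded as having each of them as source/target. A loop $(L,\cdot)$ is a set with a binary operation having a two-sided identity $e$ such that $a\cdot x=b$ and $y\cdot a=b$ have unique solutions for all $a,b$. Translations: $yR_x=y\cdot x$, $yL_x=x\cdot y$; $x^{\lambda}\cdot x=e$, $x\cdot x^{\rho}=e$; $x\backslash y$ is the unique $z$ with $x\cdot z=y$. A loop is an Osborn loop if it satisfies any one of the identities $x((yz)x)=(x^{\lambda}\backslash y)(zx)$; $x((yz)x)=\big(x((yx^{\lambda})x)\big)(zx)$; $x((yz)x)=\big(x((yx)x^{\rho})\big)(zx)$. The $A(L)$-holomorph (A-holomorph) of $(L,\cdot)$ is the loop $H(L)=(H,\circ)$ with $H=A(L)\times L$ and $(\alpha,x)\circ(\beta,y)=(\alpha\beta,\,x\beta\cdot y)$. Nuclei: $N_\rho=\{x: (zy)x=z(yx)\ \forall y,z\}$, $N_\lambda=\{x: x(yz)=(xy)z\ \forall y,z\}$, $N_\mu=\{x:(zx)y=z(xy)\ \forall y,z\}$. $AUT(L,\cdot)$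 is the group of triples $(A,B,C)$ of bijections of $L$ with $xA\cdot yB=(x\cdot y)C$ for all $x,y$. With $I$ the identity map: $\mathcal{P}(L,\cdot)=\{U:(I,U,U)\in AUT\}$; $\Lambda(L,\cdot)=\{U:(U,I,U)\in AUT\}$; $\Phi(L,\cdot)$ is the group of bijections $U$ having a bijection $U'$ (the adjoint of $U$) with $(U,U'^{-1},I)\in AUT$; $\Psi(L,\cdot)$ is the group of all adjoints $U'$. The maps are $\psi:\mathcal{P}\to N_\rho$, $\psi(U)=eU$; $\delta:\Lambda\to N_\lambda$, $\delta(U)=eU$; $\varphi:\Phi\to\Psi$, $\varphi(U)=U'$; $\sigma:\Phi\to N_\mu$, $\sigma(U)=eU$; $\beta:\Psi\to N_\mu$, $\beta(U')=eU'$. The paper recalls from earlier work that these are group isomorphisms.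
   Formalization: With left-to-right composition, φ, δ and β reverse products (L_aL_b=L_{ba}), so ''isomorphism'' fails for them when L is a nonabelian group and A(L)=1; they are stated as anti-isomorphisms (bijective, product-reversing), while σ and ψ are isomorphisms. *)

(* Defs.v *)
From HB Require Import structures.
From mathcomp Require Import all_boot all_classical.

Set Implicit Arguments.
Unset Strict Implicit.
Unset Printing Implicit Defensive.

Local Open Scope classical_set_scope.
Local Open Scope group_scope.

(* [M] need not be associative: the nuclei of a loop [L] are groups under the
   multiplication of [L]. *)
Definition is_group (M : umagmaType) (G : set M) : Prop :=
  [/\ G 1,
      forall x y, G x -> G y -> G (x * y),
      forall x y z, G x -> G y -> G z -> x * (y * z) = (x * y) * z &
      forall x, G x -> exists y, [/\ G y, x * y = 1 & y * x = 1]].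

Definition group_iso (M N : umagmaType) (G : set M) (H : set N) (f : M -> N)
    : Prop :=
  [/\ is_group G, is_group H, set_bij G H f &
      forall u v, G u -> G v -> f (u * v) = f u * f v].

(* An isomorphism from [G] onto the opposite group of [H]. *)
Definition group_antiiso (M N : umagmaType) (G : set M) (H : set N)
    (f : M -> N) : Prop :=
  [/\ is_group G, is_group H, set_bij G H f &
      forall u v, G u -> G v -> f (u * v) = f v * f u].

Record bijection (L : choiceType) := Bijection {
  bij_fun :> L -> L;
  _ : `[< bijective bij_fun >]
}.

HB.instance Definition _ (L : choiceType) := [isSub for @bij_fun L].
HB.instance Definition _ (L : choiceType) := [Choice of bijection L by <:].

Section Bijections.
Variable L : choiceType.
Implicit Types (U V W : bijection L).

Definition mkbij (f : L -> L) (fbij : bijective f) : bijection L :=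
  Bijection (asboolT fbij).

Lemma bijP U : bijective U.
Proof. exact: asboolW (valP U). Qed.

Lemma bij_eqP U V : (forall x, U x = V x) -> U = V.
Proof. by move=> UV; apply: val_inj; apply: funext. Qed.

Definition bij_one : bijection L := 
  mkbij (@Bijective _ _ id id (fun=> erefl) (fun=> erefl)).

(* Maps are written on the right: [U * V] is [U] followed by [V]. *)
Definition bij_mul U V : bijection L := mkbij (bij_comp (bijP V) (bijP U)).

Fact bij_inv_ex U : exists V, cancel U V /\ cancel V U.
Proof.
have [g Ug gU] := bijP U.
by exists (mkbij (Bijective gU Ug)).
Qed.

Definition bij_inv U : bijection L := sval (cid (bij_inv_ex U)).

Lemma bij_invK U : cancel U (bij_inv U).
Proof. by rewrite /bij_inv; case: cid => V []. Qed.

Lemma bij_invKV U : cancel (bij_inv U) U.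
Proof. by rewrite /bij_inv; case: cid => V []. Qed.

Fact bij_mulA : associative bij_mul.
Proof. by move=> U V W; apply: bij_eqP. Qed.

Fact bij_mul1 : left_id bij_one bij_mul.
Proof. by move=> U; apply: bij_eqP. Qed.

Fact bij_mulr1 : right_id bij_one bij_mul.
Proof. by move=> U; apply: bij_eqP. Qed.

Fact bij_mulV : left_inverse bij_one bij_inv bij_mul.
Proof. by move=> U; apply: bij_eqP => x; apply: bij_invKV. Qed.

Fact bij_mulrV : right_inverse bij_one bij_inv bij_mul.
Proof. by move=> U; apply: bij_eqP => x; apply: bij_invK. Qed.

HB.instance Definition _ := isGroup.Build (bijection L)
  bij_mulA bij_mul1 bij_mulr1 bij_mulV bij_mulrV.

Lemma bijME U V x : (U * V) x = V (U x). Proof. by []. Qed.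

Lemma bij1E x : (1 : bijection L) x = x. Proof. by []. Qed.

Lemma bijK U : cancel U (U^-1)%g. Proof. exact: bij_invK. Qed.

Lemma bijKV U : cancel (U^-1)%g U. Proof. exact: bij_invKV. Qed.

End Bijections.

HB.mixin Record UMagma_isLoop L of UMagma L := {
  ldiv_uniq : forall a b : L, exists! x, a * x = b;
  rdiv_uniq : forall a b : L, exists! y, y * a = b
}.

#[short(type="loopType")]
HB.structure Definition Loop := {L of UMagma_isLoop L & UMagma L}.

Section LoopTheory.
Variable L : loopType.
Implicit Types x y z a b : L.

Definition ldiv a b : L := sval (cid (ldiv_uniq a b)).
Definition rdiv b a : L := sval (cid (rdiv_uniq a b)).

(* [linv x] is x^lambda and [rinv x] is x^rho. *)
Definition linv x : L := rdiv 1 x.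
Definition rinv x : L := ldiv x 1.

Lemma mul_ldiv a b : a * ldiv a b = b.
Proof. by rewrite /ldiv; case: cid => x []. Qed.

Lemma mul_rdiv a b : rdiv b a * a = b.
Proof. by rewrite /rdiv; case: cid => x []. Qed.

Lemma ldiv_mul a x : ldiv a (a * x) = x.
Proof. by rewrite /ldiv; case: cid => y /= [_]; apply. Qed.

Lemma rdiv_mul a y : rdiv (y * a) a = y.
Proof. by rewrite /rdiv; case: cid => x /= [_]; apply. Qed.

Fact Rtr_bij x : bijective (fun y => y * x).
Proof.
by exists (rdiv^~ x) => y /=; [rewrite rdiv_mul | rewrite mul_rdiv].
Qed.

Fact Ltr_bij x : bijective (fun y => x * y).
Proof.
by exists (ldiv x) => y /=; [rewrite ldiv_mul | rewrite mul_ldiv].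
Qed.

Definition Rtr x : bijection L := mkbij (Rtr_bij x).
Definition Ltr x : bijection L := mkbij (Ltr_bij x).

Definition osborn : Prop :=
  [\/ forall x y z, x * ((y * z) * x) = ldiv (linv x) y * (z * x),
      forall x y z,
        x * ((y * z) * x) = (x * ((y * linv x) * x)) * (z * x) |
      forall x y z,
        x * ((y * z) * x) = (x * ((y * x) * rinv x)) * (z * x)].

Definition N_rho : set L := [set x | forall y z, (z * y) * x = z * (y * x)].
Definition N_lam : set L := [set x | forall y z, x * (y * z) = (x * y) * z].
Definition N_mu : set L := [set x | forall y z, (z * x) * y = z * (x * y)].

Implicit Types U V W : bijection L.

Definition autotopism U V W : Prop := forall x y, U x * V y = W (x * y).

Definition is_adjoint U U' : Prop := autotopism U U'^-1 1.

Definition P_grp : set (bijection L) := [set U | autotopism 1 U U].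
Definition Lam_grp : set (bijection L) := [set U | autotopism U 1 U].
Definition Phi_grp : set (bijection L) := [set U | exists U', is_adjoint U U'].
Definition Psi_grp : set (bijection L) := [set U' | exists U, is_adjoint U U'].

(* Junk value 1 outside [Phi_grp]. *)
Definition phi_map U : bijection L := xget 1 [set U' | is_adjoint U U'].

Lemma adjoint_uniq U V W : is_adjoint U V -> is_adjoint U W -> V = W.
Proof.
move=> UV UW; rewrite -[V]invgK -[W]invgK; congr (_^-1); apply: bij_eqP => x.
by rewrite -[LHS](ldiv_mul (U 1)) UV -UW ldiv_mul.
Qed.

Lemma phi_mapE U U' : is_adjoint U U' -> phi_map U = U'.
Proof.
move=> UU'; apply: (adjoint_uniq (U := U)) => //.
by apply: (xgetPex 1); exists U'.
Qed.

Definition psi_map U : L := U 1.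
Definition delta_map U : L := U 1.
Definition sigma_map U : L := U 1.
Definition beta_map U : L := U 1.

(* Products of bijections are read from left to right, so
   [Rtr a * Rtr b = Rtr (a * b)] when [a] or [b] is in the appropriate nucleus,
   but [Ltr a * Ltr b = Ltr (b * a)].  Hence [psi_map] and [sigma_map] preserve
   products, whereas [phi_map], [delta_map] and [beta_map] reverse them: these
   three are isomorphisms when [Lam_grp] and [Psi_grp] carry the opposite
   product. Already for a nonabelian group [L], [delta_map] is not a
   homomorphism for the left-to-right product. *)

End LoopTheory.

Arguments N_rho L : clear implicits.
Arguments N_lam L : clear implicits.
Arguments N_mu L : clear implicits.
Arguments P_grp L : clear implicits.
Arguments Lam_grp L : clear implicits.
Arguments Phi_grp L : clear implicits.
Arguments Psi_grp L : clear implicits.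
Arguments osborn L : clear implicits.

(* An arbitrary group of automorphisms of [L], not necessarily the full one. *)
Record autGroup (L : loopType) := AutGroup {
  aut_set :> set (bijection L);
  aut_is_group : is_group aut_set;
  aut_morph : forall alpha, aut_set alpha -> {morph alpha : x y / x * y}
}.

Definition holomorph (L : loopType) (A : autGroup L) : Type :=
  (set_type A * L)%type.

HB.instance Definition _ (L : loopType) (A : autGroup L) :=
  Choice.on (holomorph A).

Section Holomorph.
Variables (L : loopType) (A : autGroup L).
Implicit Types (alpha beta : set_type A) (p q r : holomorph A).

Fact aut_mulP alpha beta : val alpha * val beta \in (A : set _).
Proof.
by have [_ AM _ _] := aut_is_group A; apply/mem_set/AM; apply/set_mem/valP.
Qed.

Fact aut_oneP : 1 \in (A : set (bijection L)).
Proof. by have [A1 _ _ _] := aut_is_group A; apply/mem_set. Qed.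

Definition aut_mul alpha beta : set_type A := exist (fun a => a \in (A : set _)) _ (aut_mulP alpha beta).
Definition aut_one : set_type A := exist (fun a => a \in (A : set _)) _ aut_oneP.

Definition hol_mul p q : holomorph A :=
  (aut_mul p.1 q.1, val q.1 p.2 * q.2).

Definition hol_one : holomorph A := (aut_one, 1).

Fact aut_valM alpha x y : val alpha (x * y) = val alpha x * val alpha y.
Proof. exact: aut_morph (set_mem (valP alpha)) x y. Qed.

Fact aut_val1 alpha : val alpha 1 = 1.
Proof.
by rewrite -[LHS](ldiv_mul (val alpha 1)) -aut_valM mulg1 -[X in ldiv _ X]mulg1
           ldiv_mul.
Qed.

Fact aut_inv_ex alpha :
  exists beta, aut_mul alpha beta = aut_one /\ aut_mul beta alpha = aut_one.
Proof.
have [_ _ _ /(_ _ (set_mem (valP alpha))) [b [Ab ab ba]]] := aut_is_group A.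
by exists (exist (fun a => a \in (A : set _)) b (mem_set Ab)); split; apply: val_inj.
Qed.

Fact aut_mulA : associative aut_mul.
Proof. by move=> a b c; apply: val_inj; apply: mulgA. Qed.

Fact aut_mul1 : left_id aut_one aut_mul.
Proof. by move=> a; apply: val_inj; apply: mul1g. Qed.

Fact aut_mulr1 : right_id aut_one aut_mul.
Proof. by move=> a; apply: val_inj; apply: mulg1. Qed.

Fact hol_mul1 : left_id hol_one hol_mul.
Proof.
by case=> a x; rewrite /hol_mul /= aut_mul1 aut_val1 mul1g.
Qed.

Fact hol_mulr1 : right_id hol_one hol_mul.
Proof. by case=> a x; rewrite /hol_mul /= aut_mulr1 mulg1. Qed.

HB.instance Definition _ := hasMul.Build (holomorph A) hol_mul.
HB.instance Definition _ := Magma_isUMagma.Build (holomorph A)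
  hol_mul1 hol_mulr1.

Lemma hol_mulE (p q : holomorph A) :
  p * q = (aut_mul p.1 q.1, val q.1 p.2 * q.2).
Proof. by []. Qed.

Fact aut_mulK alpha beta :
  aut_mul alpha beta = aut_one -> cancel (val alpha) (val beta).
Proof. by move=> ab x; rewrite -bijME -[_ * _]/(val (aut_mul _ _)) ab. Qed.

Fact hol_ldiv_uniq p q : exists! r, p * r = q.
Proof.
case: p q => a x [b y]; have [a' [aa' a'a]] := aut_inv_ex a.
exists (aut_mul a' b, ldiv (val b (val a' x)) y); split.
  by rewrite hol_mulE /= aut_mulA aa' aut_mul1 mul_ldiv.
case=> c z; rewrite hol_mulE /= => -[<- <-].
by rewrite aut_mulA a'a aut_mul1 bijME (aut_mulK a'a) ldiv_mul.
Qed.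

Fact hol_rdiv_uniq p q : exists! r, r * p = q.
Proof.
case: p q => a x [b y]; have [a' [aa' a'a]] := aut_inv_ex a.
exists (aut_mul b a', val a' (rdiv y x)); split.
  by rewrite hol_mulE /= -aut_mulA a'a aut_mulr1 (aut_mulK a'a) mul_rdiv.
case=> c z; rewrite hol_mulE /= => -[<- <-].
by rewrite -aut_mulA aa' aut_mulr1 rdiv_mul (aut_mulK aa').
Qed.

HB.instance Definition _ := UMagma_isLoop.Build (holomorph A)
  hol_ldiv_uniq hol_rdiv_uniq.

End Holomorph.

(* Main.v *)
(* An Osborn loop has, for every x, the autotopism
   (L_{x^lambda}^-1, R_x, R_x L_x); this forces the three nuclei to
   coincide, and conjugation by it preserves the group of left
   translations by nuclear elements.  The Osborn identity of the holomorph,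
   evaluated on (1,x), (beta,y), (1,z), gives in addition the
   autotopism (R_x L_{x beta} R_x^-1, R_x, R_x L_{x beta}).  Dividing it by the
   instance beta = 1 shows that L_x^-1 L_{x beta} is a left translation by an
   element of the left nucleus, namely x beta . x^rho, and conjugating that
   translation gives the nuclearity of x^lambda . x beta.  Once the nuclei are
   equal, the four groups of maps are the translations by this nucleus and every
   map of the triangles is the evaluation at the identity or R_n |-> L_n. *)

Require Import Defs.
From mathcomp Require Import all_boot all_classical.

Local Open Scope classical_set_scope.
Local Open Scope group_scope.

(** * Transport of group structure along bijections *)

Section GroupIso.
Variables (M N : umagmaType) (G : set M) (H : set N) (f : M -> N).
Hypotheses (gG : is_group G) (fGH : set_bij G H f) (f1 : f 1 = 1).

(** [N] is only a unital magma, so the group axioms for [H] are carried over from [G] through the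
    surjectivity of [f]. *)
Lemma group_iso_intro :
  (forall u v, G u -> G v -> f (u * v) = f u * f v) -> group_iso G H f.
Proof.
move=> fM; split=> //; case: gG => G1 GM GA GV; case: fGH => fG _ fH.
split=> [|x y|x y z|x]; first by rewrite -f1; apply: fG.
- move=> /fH[u Gu <-] /fH[v Gv <-]; rewrite -fM //; exact/fG/GM.
- move=> /fH[u Gu <-] /fH[v Gv <-] /fH[w Gw <-].
  by rewrite -!fM //; [rewrite GA | apply: GM | apply: GM].
- move=> /fH[u Gu <-]; have [v [Gv uv vu]] := GV u Gu.
  by exists (f v); rewrite -!fM // uv vu; split=> //; apply: fG.
Qed.

Lemma group_antiiso_intro :
  (forall u v, G u -> G v -> f (u * v) = f v * f u) -> group_antiiso G H f.
Proof.
move=> fM; split=> //; case: gG => G1 GM GA GV; case: fGH => fG _ fH.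
split=> [|x y|x y z|x]; first by rewrite -f1; apply: fG.
- move=> /fH[u Gu <-] /fH[v Gv <-]; rewrite -fM //; exact/fG/GM.
- move=> /fH[u Gu <-] /fH[v Gv <-] /fH[w Gw <-].
  by rewrite -!fM //; [rewrite GA | apply: GM | apply: GM].
- move=> /fH[u Gu <-]; have [v [Gv uv vu]] := GV u Gu.
  by exists (f v); rewrite -!fM // uv vu; split=> //; apply: fG.
Qed.

End GroupIso.

(** * Inverses and autotopisms in an arbitrary loop *)

Section Loops.
Context {L : loopType}.
Implicit Types (x y z n : L) (U V W : bijection L).

Lemma loop_mulIl {x y z} : x * y = x * z -> y = z.
Proof. by move=> /(congr1 (ldiv x)); rewrite !ldiv_mul. Qed.

Lemma loop_mulIr {x y z} : y * x = z * x -> y = z.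
Proof. by move=> /(congr1 (fun t => rdiv t x)); rewrite !rdiv_mul. Qed.

Lemma linv_mul x : linv x * x = 1.
Proof. exact: mul_rdiv. Qed.

Lemma mul_rinv x : x * rinv x = 1.
Proof. exact: mul_ldiv. Qed.

Lemma linv_rinv x : linv (rinv x) = x.
Proof. by apply: (@loop_mulIr (rinv x)); rewrite linv_mul mul_rinv. Qed.

Lemma Ltr_inv1 x : (Ltr x)^-1 1 = rinv x.
Proof. by apply: (@loop_mulIl x); rewrite mul_rinv; apply: (bijKV (Ltr x)). Qed.

Lemma Ltr_linv_inv1 x : (Ltr (linv x))^-1 1 = x.
Proof.
by apply: (@loop_mulIl (linv x)); rewrite linv_mul; apply: (bijKV (Ltr _)).
Qed.

Section Autotopisms.
Implicit Types A B C : bijection L.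

Lemma autotopismM {A B C A' B' C'} :
  autotopism A B C -> autotopism A' B' C' ->
  autotopism (A * A') (B * B') (C * C').
Proof. by move=> h h' x y; rewrite !bijME h' h. Qed.

Lemma autotopismV {A B C} : autotopism A B C -> autotopism A^-1 B^-1 C^-1.
Proof. by move=> h x y; rewrite -[LHS](bijK C) -h !bijKV. Qed.

(** Setting the second argument to 1 gives [U = W]; setting the first to 1 then makes [U] a left
    translation. *)
Lemma autotopism_left {U W} :
  autotopism U 1 W -> U = Ltr (U 1) /\ N_lam L (U 1).
Proof.
move=> UW; have UWE x : U x = W x by have := UW x 1; rewrite bij1E !mulg1.
have UE x : U x = U 1 * x by rewrite UWE -[x in LHS]mul1g -UW bij1E.
split=> [|y z]; first exact: bij_eqP.
by rewrite -!UE UWE -UW.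
Qed.

End Autotopisms.

(** * The four groups of bijections as nuclear translations *)

Lemma P_grpE : P_grp L = @Rtr L @` N_rho L.
Proof.
apply/seteqP; split=> [U UP | _ [n Nn <-] x y]; last by rewrite /= -Nn.
have UE x : U x = x * U 1 by rewrite UP mulg1.
exists (U 1); last by apply: bij_eqP => x; rewrite [RHS]UE.
by move=> y z; rewrite -!UE -UP.
Qed.

Lemma Lam_grpE : Lam_grp L = @Ltr L @` N_lam L.
Proof.
apply/seteqP; split=> [U /autotopism_left[UL Un] | _ [n Nn <-] x y].
  by exists (U 1).
by rewrite /= Nn.
Qed.

(** Adjointness means [U x * y = x * V y]; the cases [y = 1] and [x = 1] turn both maps into
    translations by [V 1]. *)
Lemma is_adjointP U V :
  is_adjoint U V <-> exists2 n, N_mu L n & U = Rtr n /\ V = Ltr n.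
Proof.
split=> [UV | [n Nn [-> ->]] x y]; last first.
  by rewrite /= Nn; congr (_ * _); apply: (bijKV (Ltr n)).
have UVE x y : U x * y = x * V y by rewrite -[in LHS](bijK V y) UV.
have UE x : U x = x * V 1 by rewrite -UVE mulg1.
have VE x : V x = V 1 * x by rewrite -[LHS]mul1g -UVE UE mul1g.
exists (V 1); last by split; apply: bij_eqP => x; [exact: UE | exact: VE].
by move=> y z; rewrite -UE -VE UVE.
Qed.

Lemma Phi_grpE : Phi_grp L = @Rtr L @` N_mu L.
Proof.
apply/seteqP; split=> [U [V /is_adjointP[n Nn [-> _]]] | _ [n Nn <-]].
  by exists n.
by exists (Ltr n); apply/is_adjointP; exists n.
Qed.

Lemma Psi_grpE : Psi_grp L = @Ltr L @` N_mu L.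
Proof.
apply/seteqP; split=> [V [U /is_adjointP[n Nn [_ ->]]] | _ [n Nn <-]].
  by exists n.
by exists (Rtr n); apply/is_adjointP; exists n.
Qed.

Lemma phi_map_Rtr n : N_mu L n -> phi_map (Rtr n) = Ltr n.
Proof. by move=> Nn; apply/phi_mapE/is_adjointP; exists n. Qed.

(** * The isomorphisms valid in every loop *)

Lemma is_adjoint1 : is_adjoint (1 : bijection L) 1.
Proof. by rewrite /is_adjoint invg1. Qed.

(** The second components compose to [U'^-1 * V'^-1], the inverse of [V' * U']; hence [phi_map]
    reverses products. *)
Lemma is_adjointM {U U' V V'} :
  is_adjoint U U' -> is_adjoint V V' -> is_adjoint (U * V) (V' * U').
Proof.
by move=> hU hV; have := autotopismM hU hV; rewrite mulg1 /is_adjoint invgM.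
Qed.

Lemma is_adjointV {U U'} : is_adjoint U U' -> is_adjoint U^-1 U'^-1.
Proof. by move=> /autotopismV; rewrite invg1. Qed.

Lemma Phi_grp_group : is_group (Phi_grp L).
Proof.
split=> [|U V [U' hU] [V' hV]|U V W _ _ _|U [U' hU]].
- by exists 1; apply: is_adjoint1.
- by exists (V' * U'); apply: is_adjointM.
- exact: mulgA.
- exists U^-1; rewrite mulgV mulVg; split=> //.
  by exists U'^-1; apply: is_adjointV.
Qed.

Lemma Psi_grp_group : is_group (Psi_grp L).
Proof.
split=> [|U V [U' hU] [V' hV]|U V W _ _ _|U [U' hU]].
- by exists 1; apply: is_adjoint1.
- by exists (V' * U'); apply: is_adjointM.
- exact: mulgA.
- exists U^-1; rewrite mulgV mulVg; split=> //.
  by exists U'^-1; apply: is_adjointV.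
Qed.

Lemma eval1_bij (F : L -> bijection L) (N : set L) :
  (forall n, F n 1 = n) -> set_bij (F @` N) N (fun U => U 1).
Proof.
move=> F1; split=> [_ [n Nn <-]|_ _ /set_mem[m _ <-] /set_mem[n _ <-]|n Nn] /=.
- by rewrite F1.
- by rewrite !F1 => ->.
- by exists (F n) => //; exists n.
Qed.

Lemma Rtr1 n : Rtr n 1 = n. Proof. exact: mul1g. Qed.

Lemma Ltr1 n : Ltr n 1 = n. Proof. exact: mulg1. Qed.

Lemma sigma_iso : group_iso (Phi_grp L) (N_mu L) (@sigma_map L).
Proof.
apply: group_iso_intro => //; first exact: Phi_grp_group.
  by rewrite Phi_grpE; apply/eval1_bij/Rtr1.
by rewrite Phi_grpE => _ _ [m _ <-] [n _ <-]; rewrite /sigma_map bijME !Rtr1.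
Qed.

Lemma beta_antiiso : group_antiiso (Psi_grp L) (N_mu L) (@beta_map L).
Proof.
apply: group_antiiso_intro => //; first exact: Psi_grp_group.
  by rewrite Psi_grpE; apply/eval1_bij/Ltr1.
by rewrite Psi_grpE => _ _ [m _ <-] [n _ <-]; rewrite /beta_map bijME !Ltr1.
Qed.

Lemma phi_antiiso : group_antiiso (Phi_grp L) (Psi_grp L) (@phi_map L).
Proof.
apply: group_antiiso_intro => [||| U V [U' hU] [V' hV]].
- exact: Phi_grp_group.
- rewrite Phi_grpE Psi_grpE; split=> [_ [n Nn <-]| |_ [n Nn <-]].
  + by exists n => //; rewrite phi_map_Rtr.
  + move=> _ _ /set_mem[m Nm <-] /set_mem[n Nn <-]; rewrite !phi_map_Rtr //.
    by move=> /(congr1 (fun U => U 1)); rewrite !Ltr1 => ->.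
  + by exists (Rtr n); [exists n | rewrite phi_map_Rtr].
- exact/phi_mapE/is_adjoint1.
- by rewrite (phi_mapE hU) (phi_mapE hV); apply/phi_mapE/is_adjointM.
Qed.

Lemma sigma_phi U : Phi_grp L U -> sigma_map U = phi_map U 1.
Proof.
by rewrite Phi_grpE => -[n Nn <-]; rewrite phi_map_Rtr // Ltr1 /sigma_map Rtr1.
Qed.

(* All three forms give [x((yz)x) = (y B)(zx)] for some map [B]; taking [z = 1]
   forces [(y B) x = x(yx)]. *)
Lemma osborn_mul : osborn L ->
  forall x y z w, w * x = x * (y * x) -> w * (z * x) = x * (y * z * x).
Proof.
have key (B : L -> L -> L) :
    (forall x y z, x * (y * z * x) = B x y * (z * x)) ->
    forall x y z w, w * x = x * (y * x) -> w * (z * x) = x * (y * z * x).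
  move=> OB x y z w; have := OB x y 1; rewrite mulg1 mul1g => ->.
  by move=> /loop_mulIr ->; rewrite OB.
case=> O; first exact: (key (fun x y => ldiv (linv x) y)).
  exact: (key (fun x y => x * ((y * linv x) * x))).
exact: (key (fun x y => x * ((y * x) * rinv x))).
Qed.

(** The first component sends [y] to the solution [w] of [w * x = x * (y * x)], a form independent
    of which of the three Osborn identities holds. *)
Definition osborn_autotopic : Prop :=
  forall x, autotopism (Rtr x * Ltr x * (Rtr x)^-1) (Rtr x) (Rtr x * Ltr x).

(** * Coincidence of the nuclei of an Osborn loop *)

Section Osborn.
Hypothesis oL : osborn_autotopic.

(** The left side [A] sends [linv x] to 1, so the autotopism at [linv x] reads
    [z * x = x * (linv x * z * x)], and the right side here is [A (linv x * z) * x]. *)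
Lemma osborn_conj x : Rtr x * Ltr x * (Rtr x)^-1 = (Ltr (linv x))^-1.
Proof.
set A := _ * _^-1.
have Ax y : A y * x = x * (y * x) by exact: (bijKV (Rtr x)).
have A1 : A (linv x) = 1.
  by apply: (@loop_mulIr x); rewrite Ax linv_mul mulg1 mul1g.
apply: (mulgI (Ltr (linv x))); rewrite mulgV; apply: bij_eqP => z.
apply: (@loop_mulIr x); rewrite bijME Ax.
have := oL x (linv x) z; rewrite -/A A1 mul1g; exact: esym.
Qed.

Lemma osborn_autotopism x :
  autotopism (Ltr (linv x))^-1 (Rtr x) (Rtr x * Ltr x).
Proof. by rewrite -osborn_conj; apply: oL. Qed.

Lemma osborn_mul_linv x y z : y * (z * x) = x * (linv x * y * z * x).
Proof.
have := osborn_autotopism x (Ltr (linv x) y) z.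
by rewrite bijK /= => ->.
Qed.

(** Comparing [osborn_mul_linv] at [y, n] and at [y * n, 1] makes [y * (n * x) = (y * n) * x]
    equivalent to [(linv x * y) * n = linv x * (y * n)]. *)
Lemma osborn_N_rho_mu : N_rho L = N_mu L.
Proof.
apply/seteqP; split=> n Nn.
  move=> x y; rewrite [RHS]osborn_mul_linv Nn.
  by have := osborn_mul_linv x (y * n) 1; rewrite mul1g mulg1.
(* Every element is a left inverse, so the comparison also covers an arbitrary left factor. *)
move=> y x; rewrite -(linv_rinv x); set t := rinv x.
apply/(@loop_mulIr t)/(@loop_mulIl t); rewrite -osborn_mul_linv -Nn.
by have := osborn_mul_linv t (y * n) 1; rewrite mul1g mulg1.
Qed.

(** Dividing the Osborn autotopism at [n] by [(1, Rtr n, Rtr n)] leaves middle component 1 and a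
    first component sending 1 to [n]; dividing it by [(Ltr n, 1, Ltr n)] leaves
    [(1, Rtr n, Rtr n)]. *)
Lemma osborn_N_lam_rho : N_lam L = N_rho L.
Proof.
apply/seteqP; split=> n Nn; last first.
  have Rn : autotopism 1 (Rtr n) (Rtr n) by move=> x y; rewrite /= -Nn.
  have := autotopismM (osborn_autotopism n) (autotopismV Rn).
  rewrite mulgV => /autotopism_left[_].
  by rewrite invg1 mulg1 Ltr_linv_inv1.
have Ln : autotopism (Ltr n) 1 (Ltr n) by move=> x y; rewrite /= Nn.
have nV : n * linv n = 1.
  by apply: (@loop_mulIr n); rewrite -Nn linv_mul mulg1 mul1g.
have LnE : (Ltr (linv n))^-1 = Ltr n.
  apply: (mulgI (Ltr (linv n))); rewrite mulgV; apply: bij_eqP => z.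
  by rewrite bijME /= Nn nV mul1g.
have := autotopismM (osborn_autotopism n) (autotopismV Ln).
rewrite LnE mulgV -mulgA mulgV invg1 !mulg1 => Rn y z.
exact: esym (Rn z y).
Qed.

Lemma osborn_linv_mul_N_lam x n : N_lam L n -> N_lam L (linv x * (n * x)).
Proof.
move=> Nn; have Ln : autotopism (Ltr n) 1 (Ltr n) by move=> ? ?; rewrite /= Nn.
have T := osborn_autotopism x.
have := autotopismM (autotopismM T Ln) (autotopismV T).
rewrite mulg1 mulgV invgK => /autotopism_left[_].
by rewrite !bijME Ltr_linv_inv1.
Qed.

End Osborn.
End Loops.

Arguments osborn_autotopic L : clear implicits.

(** * Autotopisms of the loop induced by its holomorph *)

Section Holomorph.
Context {L : loopType} {A : autGroup L}.
Hypothesis oH : osborn (holomorph A).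
Implicit Types (x : L) (beta : bijection L).

Lemma holomorph_autotopism {beta} x : aut_set A beta ->
  autotopism (Rtr x * Ltr (beta x) * (Rtr x)^-1) (Rtr x)
             (Rtr x * Ltr (beta x)).
Proof.
move=> Ab y z; pose b : set_type A := exist _ beta (mem_set Ab).
pose w := (Rtr x * Ltr (beta x) * (Rtr x)^-1) y.
have wx : w * x = beta x * (y * x) by exact: (bijKV (Rtr x)).
pose p : holomorph A := (aut_one A, x).
(* The side condition of [osborn_mul] has second component [wx]. *)
have := osborn_mul oH p (b, y) (aut_one A, z) (b, w).
rewrite !hol_mulE /= !aut_mulr1 !aut_mul1 wx => /(_ erefl).
by case.
Qed.

Lemma holomorph_osborn : osborn_autotopic L.
Proof.
by have [A1 _ _ _] := aut_is_group A => x;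
  exact: (@holomorph_autotopism 1 x A1).
Qed.

(** In the quotient autotopism the third component sends 1 to [beta x * rinv x], and the first sends
    1 to the right quotient of [beta x] by [x]; the two values agree. *)
Lemma holomorph_mul_rinv {beta} x : aut_set A beta ->
  N_lam L (beta x * rinv x) /\ beta x * rinv x * x = beta x.
Proof.
move=> Ab; have := holomorph_autotopism x Ab.
move=> /(autotopismM (autotopismV (holomorph_osborn x))).
rewrite (osborn_conj holomorph_osborn) invgK mulVg invgM.
rewrite -[_ * _ * (_ * Ltr (beta x))]mulgA mulKg.
set U := (U in autotopism U); set W := (W in autotopism _ _ W) => UW.
have Wx : W 1 = beta x * rinv x by rewrite /W bijME Ltr_inv1.
have U1 : U 1 = beta x * rinv x by have := UW 1 1; rewrite bij1E !mulg1 Wx.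
have [_] := autotopism_left UW; rewrite U1; split=> //.
rewrite -U1 [LHS](bijKV (Rtr x)) bijME /=.
by rewrite mulg1 linv_mul mulg1.
Qed.

End Holomorph.

Theorem theorem3p5 (L : loopType) (A : autGroup L) :
  osborn (holomorph A) ->
  (* (a) *)
  ([/\ group_antiiso (Phi_grp L) (Lam_grp L) (@phi_map L),
       group_antiiso (Phi_grp L) (Psi_grp L) (@phi_map L),
       group_antiiso (Lam_grp L) (N_lam L) (@delta_map L) &
       group_antiiso (Psi_grp L) (N_mu L) (@beta_map L)] /\
   [/\ group_iso (Phi_grp L) (N_mu L) (@sigma_map L),
       group_iso (Phi_grp L) (N_lam L) (@sigma_map L),
       forall U, Phi_grp L U -> sigma_map U = delta_map (phi_map U) &
       forall U, Phi_grp L U -> sigma_map U = beta_map (phi_map U)] /\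
   (forall (x : L) (alpha : bijection L), aut_set A alpha ->
      let n := alpha x * rinv x in
      [/\ Phi_grp L (Rtr n), Lam_grp L (Ltr n), Psi_grp L (Ltr n),
          N_lam L n & N_mu L n] /\
      [/\ phi_map (Rtr n) = Ltr n, delta_map (Ltr n) = n,
          beta_map (Ltr n) = n & sigma_map (Rtr n) = n])) /\
  (* (b) *)
  ([/\ group_antiiso (P_grp L) (Psi_grp L) (@phi_map L),
       group_antiiso (Phi_grp L) (Psi_grp L) (@phi_map L),
       group_antiiso (Psi_grp L) (N_mu L) (@beta_map L) &
       group_antiiso (Psi_grp L) (N_rho L) (@beta_map L)] /\
   [/\ group_iso (P_grp L) (N_rho L) (@psi_map L),
       group_iso (Phi_grp L) (N_mu L) (@sigma_map L),
       forall U, Phi_grp L U -> sigma_map U = beta_map (phi_map U) &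
       forall U, P_grp L U -> psi_map U = beta_map (phi_map U)] /\
   (forall (x : L) (phi : bijection L), aut_set A phi ->
      let n := linv x * phi^-1 x in
      [/\ P_grp L (Rtr n), Phi_grp L (Rtr n), Psi_grp L (Ltr n),
          N_mu L n & N_rho L n] /\
      [/\ phi_map (Rtr n) = Ltr n, beta_map (Ltr n) = n,
          psi_map (Rtr n) = n & sigma_map (Rtr n) = n])).
Proof.
move=> oH; have oL := holomorph_osborn oH.
have Nrho := osborn_N_rho_mu oL; have Nlam := osborn_N_lam_rho oL.
rewrite Nrho in Nlam.
have PPhi : P_grp L = Phi_grp L by rewrite P_grpE Phi_grpE Nrho.
have LamPsi : Lam_grp L = Psi_grp L by rewrite Lam_grpE Psi_grpE Nlam.
have key n : N_mu L n -> [/\ Phi_grp L (Rtr n), Psi_grp L (Ltr n),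
    phi_map (Rtr n) = Ltr n, Ltr n 1 = n & Rtr n 1 = n].
  rewrite Phi_grpE Psi_grpE => Nn; split; [by exists n | by exists n | | |].
  - exact: phi_map_Rtr.
  - exact: Ltr1.
  - exact: Rtr1.
have phiI := @phi_antiiso L; have betaI := @beta_antiiso L.
have sigmaI := @sigma_iso L; have sigmaE := @sigma_phi L.
rewrite PPhi LamPsi Nlam Nrho.
split; (split; [by split | split; [by split |]]) => x alpha Aalpha n.
  have [+ _] := holomorph_mul_rinv oH x Aalpha.
  by rewrite Nlam -/n => Nn; have [] := key n Nn.
have Aalpha' : aut_set A alpha^-1.
  have [_ _ _ /(_ _ Aalpha)[a' [Aa' aa' _]]] := aut_is_group A.
  suff -> : alpha^-1 = a' by [].
  by apply: (mulgI alpha); rewrite mulgV aa'.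
have [Nm mx] := holomorph_mul_rinv oH x Aalpha'.
(* [mx] writes [n] as [linv x * (m * x)] with [m = alpha^-1 x * rinv x] nuclear. *)
have Nn : N_mu L n by rewrite -Nlam /n -mx; apply: osborn_linv_mul_N_lam.
by have [] := key n Nn.
Qed.
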